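(* Let $a,b,c>0$ be real numbers with $ab\neq1$, and let $x,y$ be real. For integers $m,n\ge 0$ define $$D^{(m)}_n(x,y;a,b,c)=\frac{1}{(\ln a+\ln b)^n}\sum_{k=0}^m\binom{m}{k}E^{(-k)}_n(x;a,b,c)\left(\frac{y\ln c+\ln a}{\ln a +\ln b}\right)^{m-k}.$$ Then, as formal power series in $t,u$, $$\sum_{n=0}^{\infty}\sum_{m=0}^{\infty}D^{(m)}_n(x,y;a,b,c)\frac{t^n}{n!}\frac{u^m}{m!}=\frac{2\,e^{\left(\frac{y\ln c+\ln a}{\ln a +\ln b}\right)u}\,e^{\left(\frac{x\ln c+\ln a}{\ln a +\ln b}\right)t}\,e^{t+u}\left(1-e^{-t}\right)}{(e^t+1)(e^t+e^u-e^{t+u})}.$$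
   Context: For an integer $k$ (possibly negative), ${\rm Li}_k(z)=\sum_{m\ge 1} z^m/m^k$ (a formal power series in $z$; e.g. ${\rm Li}_{-k}(z)=\sum_{m\ge1}m^kz^m$). For real $a,b,c>0$, $a^{-t}$ means $e^{-t\ln a}$, etc. The generalized poly-Euler polynomials $E^{(k)}_n(x;a,b,c)$ are defined by $$\frac{2\,{\rm Li}_k\big(1-(ab)^{-t}\big)}{a^{-t}+b^{t}}\,c^{xt}=\sum_{n=0}^{\infty}E^{(k)}_n(x;a,b,c)\frac{t^n}{n!}.$$ *)

(* Defs.v *)
From HB Require Import structures.
From mathcomp Require Import all_boot all_order all_algebra.
From mathcomp Require Import boolp reals exp.

Set Implicit Arguments.
Unset Strict Implicit.
Unset Printing Implicit Defensive.

Import Order.TTheory GRing.Theory Num.Theory.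
Local Open Scope ring_scope.

(** * Formal power series *)

(* A record rather than [nat -> R], whose canonical ring product is pointwise. *)
Record fps (R : Type) : Type := Fps { coefs : nat -> R }.

Notation "{ 'fps' R }" := (fps R) (at level 0, format "{ 'fps'  R }").

Lemma fpsP (R : Type) (f g : {fps R}) : coefs f =1 coefs g <-> f = g.
Proof.
by split=> [|-> //]; case: f g => [f] [g] /= fg; congr Fps; apply/funext.
Qed.

HB.instance Definition _ (R : Type) := gen_eqMixin {fps R}.
HB.instance Definition _ (R : Type) := gen_choiceMixin {fps R}.

Definition fps_add (R : zmodType) (f g : {fps R}) : {fps R} :=
  Fps (fun n => coefs f n + coefs g n).

Definition fps_opp (R : zmodType) (f : {fps R}) : {fps R} :=
  Fps (fun n => - coefs f n).

Definition fps_zero (R : zmodType) : {fps R} := Fps (fun=> 0).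

Fact fps_addA (R : zmodType) : associative (@fps_add R).
Proof. by move=> f g h; apply/fpsP => n /=; rewrite addrA. Qed.

Fact fps_addC (R : zmodType) : commutative (@fps_add R).
Proof. by move=> f g; apply/fpsP => n /=; rewrite addrC. Qed.

Fact fps_add0 (R : zmodType) : left_id (fps_zero R) (@fps_add R).
Proof. by move=> f; apply/fpsP => n /=; rewrite add0r. Qed.

Fact fps_addN (R : zmodType) :
  left_inverse (fps_zero R) (@fps_opp R) (@fps_add R).
Proof. by move=> f; apply/fpsP => n /=; rewrite addNr. Qed.

HB.instance Definition _ (R : zmodType) :=
  GRing.isZmodule.Build {fps R}
    (@fps_addA R) (@fps_addC R) (@fps_add0 R) (@fps_addN R).

Definition fpsC (R : zmodType) (c : R) : {fps R} :=
  Fps (fun n => if n == 0%N then c else 0).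

Definition fps_mul (R : comNzRingType) (f g : {fps R}) : {fps R} :=
  Fps (fun n => \sum_(i < n.+1) coefs f i * coefs g (n - i)%N).

Definition fps_trunc (R : comNzRingType) (N : nat) (f : {fps R}) : {poly R} :=
  \poly_(i < N) coefs f i.

Lemma coef_fps_trunc (R : comNzRingType) N (f : {fps R}) n :
  (n < N)%N -> (fps_trunc N f)`_n = coefs f n.
Proof. by move=> nN; rewrite coef_poly nN. Qed.

Lemma coefs_mul_trunc (R : comNzRingType) N (f g : {fps R}) n : (n < N)%N ->
  coefs (fps_mul f g) n = (fps_trunc N f * fps_trunc N g)`_n.
Proof.
move=> nN; rewrite coefM /=; apply: eq_bigr => i _.
rewrite !coef_fps_trunc //; first by rewrite (leq_ltn_trans (leq_subr _ _)).
by rewrite (leq_ltn_trans _ nN) // -ltnS.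
Qed.

Fact fps_mulC (R : comNzRingType) : commutative (@fps_mul R).
Proof.
by move=> f g; apply/fpsP => n; rewrite !(@coefs_mul_trunc _ n.+1) // mulrC.
Qed.

Fact fps_mulA (R : comNzRingType) : associative (@fps_mul R).
Proof.
have trM (f g : {fps R}) n i : (i < n.+1)%N ->
    coefs (fps_mul f g) i = (fps_trunc n.+1 f * fps_trunc n.+1 g)`_i.
  exact: coefs_mul_trunc.
move=> f g h; apply/fpsP => n.
transitivity ((fps_trunc n.+1 f * (fps_trunc n.+1 g * fps_trunc n.+1 h))`_n).
  rewrite coefM; apply: eq_bigr => i _.
  by rewrite (@trM g h n) ?coef_fps_trunc // ltnS leq_subr.
rewrite mulrA coefM; apply: eq_bigr => i _.
by rewrite (@trM f g n) ?coef_fps_trunc // ltnS leq_subr.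
Qed.

Fact fps_mul1 (R : comNzRingType) : left_id (fpsC (1 : R)) (@fps_mul R).
Proof.
move=> f; apply/fpsP => n /=; rewrite big_ord_recl /= mul1r subn0.
by rewrite big1 ?addr0 // => i _; rewrite mul0r.
Qed.

Fact fps_mulDl (R : comNzRingType) : left_distributive (@fps_mul R) +%R.
Proof.
move=> f g h; apply/fpsP => n /=; rewrite -big_split /=.
by apply: eq_bigr => i _; rewrite mulrDl.
Qed.

Fact fps_one_neq0 (R : comNzRingType) : fpsC (1 : R) != 0.
Proof.
by apply/eqP => /fpsP /(_ 0%N) /= /eqP; rewrite (negPf (oner_neq0 R)).
Qed.

HB.instance Definition _ (R : comNzRingType) :=
  GRing.Zmodule_isComNzRing.Build {fps R}
    (@fps_mulA R) (@fps_mulC R) (@fps_mul1 R) (@fps_mulDl R) (fps_one_neq0 R).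

Lemma coefsD (R : zmodType) (f g : {fps R}) n :
  coefs (f + g) n = coefs f n + coefs g n.
Proof. by []. Qed.

Lemma coefsN (R : zmodType) (f : {fps R}) n : coefs (- f) n = - coefs f n.
Proof. by []. Qed.

Lemma coefs0 (R : zmodType) n : coefs (0 : {fps R}) n = 0.
Proof. by []. Qed.

Lemma coefs1 (R : comNzRingType) n :
  coefs (1 : {fps R}) n = if n == 0%N then 1 else 0.
Proof. by []. Qed.

Lemma coefsM (R : comNzRingType) (f g : {fps R}) n :
  coefs (f * g) n = \sum_(i < n.+1) coefs f i * coefs g (n - i)%N.
Proof. by []. Qed.

Lemma coefs_sum (R : zmodType) (I : Type) (r : seq I) (P : pred I)
    (F : I -> {fps R}) n :
  coefs (\sum_(i <- r | P i) F i) n = \sum_(i <- r | P i) coefs (F i) n.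
Proof. by elim/big_rec2: _ => // i f c _ <-. Qed.

Lemma coefsCM (R : comNzRingType) (c : R) (f : {fps R}) n :
  coefs (fpsC c * f) n = c * coefs f n.
Proof.
rewrite coefsM big_ord_recl /= subn0 big1 ?addr0 // => i _.
by rewrite mul0r.
Qed.

Lemma coefsX_lt (R : comNzRingType) (f : {fps R}) k n :
  coefs f 0%N = 0 -> (n < k)%N -> coefs (f ^+ k) n = 0.
Proof.
move=> f0; elim: k n => [//|k IH] n nk; rewrite exprS coefsM big1 // => i _.
case: (posnP i) => [->|i_gt0]; first by rewrite f0 mul0r.
by rewrite IH ?mulr0 //; have := ltn_ord i; case: (i : nat) i_gt0 => // j _ jn;
   rewrite ltn_subLR ?(leq_trans nk) // ?addSn ?ltnS ?leq_addl // -ltnS.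
Qed.

(* The substitution [f(g)]; the finite sum is the coefficient of the
   composition because [g] is required to have constant coefficient 0, so that
   [g ^+ k] contributes nothing in degree [n < k]. *)
Definition fps_subst (R : comNzRingType) (f g : {fps R}) : {fps R} :=
  Fps (fun n => \sum_(k < n.+1) coefs f k * coefs (g ^+ k) n).

Definition fps_unit (R : comUnitRingType) : {pred {fps R}} :=
  fun f => coefs f 0%N \is a GRing.unit.

(* [f = c (1 - h)] with [c] the constant coefficient, so that
   [1/f = c^-1 (1 + h + h^2 + ...)]. *)
Definition fps_inv (R : comUnitRingType) (f : {fps R}) : {fps R} :=
  if f \in @fps_unit R then
    let d := fpsC (coefs f 0%N)^-1 in
    d * fps_subst (Fps (fun=> 1)) (1 - d * f)
  else f.

Fact fps_mulVx (R : comUnitRingType) :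
  {in @fps_unit R, left_inverse 1 (@fps_inv R) *%R}.
Proof.
move=> f uf; rewrite /fps_inv uf; set d := fpsC _; set h := 1 - d * f.
have h0 : coefs h 0%N = 0.
  by rewrite coefsD coefsN coefsCM coefs1 /= mulVr ?subrr.
rewrite mulrAC; have -> : d * f = 1 - h by rewrite /h opprB addrC subrK.
apply/fpsP => n.
have coefG i : (i < n.+1)%N -> coefs (fps_subst (Fps (fun=> 1)) h) i =
    coefs (\sum_(k < n.+1) h ^+ k) i.
  move=> lin; rewrite coefs_sum /=.
  rewrite (big_ord_widen n.+1 (fun k => 1 * coefs (h ^+ k) i)) // big_mkcond /=.
  apply: eq_bigr => k _; case: ltnP => [|ik]; first by rewrite mul1r.
  by rewrite coefsX_lt.
transitivity (coefs ((1 - h) * \sum_(k < n.+1) h ^+ k) n).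
  by rewrite !coefsM; apply: eq_bigr => i _; rewrite coefG // ltnS leq_subr.
have -> : (1 - h) * (\sum_(k < n.+1) h ^+ k) = 1 - h ^+ n.+1.
  by rewrite -opprB mulNr -subrX1 opprB.
by rewrite coefsD coefsN coefsX_lt // subr0.
Qed.

Fact fps_unitPl (R : comUnitRingType) (f g : {fps R}) :
  g * f = 1 -> fps_unit f.
Proof.
move=> /fpsP /(_ 0%N); rewrite coefsM big_ord1 subnn => gf.
by apply/unitrPr; exists (coefs g 0%N); rewrite mulrC gf.
Qed.

Fact fps_inv_out (R : comUnitRingType) :
  {in [predC @fps_unit R], @fps_inv R =1 id}.
Proof. by move=> f; rewrite /fps_inv inE => /negPf ->. Qed.

HB.instance Definition _ (R : comUnitRingType) :=
  GRing.ComNzRing_hasMulInverse.Build {fps R}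
    (@fps_mulVx R) (@fps_unitPl R) (@fps_inv_out R).

Lemma fps_unitE (R : comUnitRingType) (f : {fps R}) :
  (f \is a GRing.unit) = (coefs f 0%N \is a GRing.unit).
Proof. by []. Qed.

Definition fpsX (R : comNzRingType) : {fps R} :=
  Fps (fun n => if n == 1%N then 1 else 0).

(** * Two variables: [R[[t, u]]] is [{fps {fps R}}], that is [R[[u]][[t]]];
    the coefficient of [t^n u^m] in [F] is [coefs (coefs F n) m]. *)

Definition fps2_t (R : comNzRingType) : {fps {fps R}} := fpsX {fps R}.
Definition fps2_u (R : comNzRingType) : {fps {fps R}} := fpsC (fpsX R).
Definition fps2C (R : comNzRingType) (c : R) : {fps {fps R}} := fpsC (fpsC c).

(* [f(G)] for [G] with constant coefficient 0; [G ^+ k] then only has terms of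
   total degree at least [k]. *)
Definition fps2_subst (R : comNzRingType) (f : {fps R}) (G : {fps {fps R}}) :
    {fps {fps R}} :=
  Fps (fun n => Fps (fun m =>
    \sum_(k < (n + m).+1) coefs f k * coefs (coefs (G ^+ k) n) m)).

(** * Exponentials and polylogarithms *)

Definition fps_expS (R : comUnitRingType) : {fps R} :=
  Fps (fun n => (n`!%:R)^-1).

Definition fps_exp (R : comUnitRingType) (g : {fps R}) : {fps R} :=
  fps_subst (fps_expS R) g.

Definition fps2_exp (R : comUnitRingType) (G : {fps {fps R}}) :
    {fps {fps R}} :=
  fps2_subst (fps_expS R) G.

(* [a^(r t) = e^(r t ln a)] as a series in [t] *)
Definition fps_pow (R : realType) (a r : R) : {fps R} :=
  fps_exp (fpsC (r * ln a) * fpsX R).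

Lemma coefs_fps_pow0 (R : realType) (a r : R) : coefs (fps_pow a r) 0%N = 1.
Proof. by rewrite /= big_ord1 expr0 /= invr1 mulr1. Qed.

Lemma coefs_fps2_exp00 (R : comUnitRingType) (G : {fps {fps R}}) :
  coefs (coefs (fps2_exp G) 0%N) 0%N = 1.
Proof. by rewrite /= big_ord1 expr0 /= invr1 mulr1. Qed.

Definition Li (R : realType) (k : int) : {fps R} :=
  Fps (fun m => if m == 0%N then 0 else ((m%:R : R) ^ k)^-1).

(** * Generalized poly-Euler polynomials *)

Definition polyEuler_gf (R : realType) (k : int) (x a b c : R) : {fps R} :=
  2 * fps_subst (Li R k) (1 - fps_pow (a * b) (-1))
    / (fps_pow a (-1) + fps_pow b 1) * fps_pow c x.

Lemma polyEuler_gf_den_unit (R : realType) (a b : R) :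
  fps_pow a (-1) + fps_pow b 1 \is a GRing.unit.
Proof. by rewrite fps_unitE coefsD !coefs_fps_pow0 unitfE (pnatr_eq0 R 2). Qed.

Definition polyEuler (R : realType) (k : int) (n : nat) (x a b c : R) : R :=
  n`!%:R * coefs (polyEuler_gf k x a b c) n.

Lemma polyEuler_gfE (R : realType) (k : int) (x a b c : R) :
  polyEuler_gf k x a b c = Fps (fun n => polyEuler k n x a b c / n`!%:R).
Proof.
apply/fpsP => n; rewrite [RHS]/= /polyEuler mulrAC mulfV ?mul1r //.
by rewrite pnatr_eq0 -lt0n fact_gt0.
Qed.

Definition Dmn (R : realType) (m n : nat) (x y a b c : R) : R :=
  1 / (ln a + ln b) ^+ n *
  \sum_(0 <= k < m.+1)
    'C(m, k)%:R * polyEuler (- k%:Z) n x a b c *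
    ((y * ln c + ln a) / (ln a + ln b)) ^+ (m - k).

Lemma Dmn_gf_den_unit (R : realType) (t := fps2_t R) (u := fps2_u R)
    (e := @fps2_exp R) :
  (e t + 1) * (e t + e u - e (t + u)) \is a GRing.unit.
Proof.
have e0 G : coefs (coefs (e G) 0%N) 0%N = 1 := coefs_fps2_exp00 G.
clearbody e t u.
rewrite unitrM.
rewrite (fps_unitE (e t + 1)).
rewrite (fps_unitE (e t + e u - _)).
rewrite (coefsD (e t)).
rewrite (fps_unitE (coefs (e t) _ + _)).
rewrite (coefsD (coefs (e t) _)) e0.
rewrite (coefsD (e t + e u)) (coefsD (e t)) (coefsN (e _)).
rewrite fps_unitE (coefsD (_ + _)) (coefsD (coefs (e t) _)) coefsN !e0.
by rewrite addrK unitr1 unitfE (pnatr_eq0 R 2).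
Qed.

(* Main.v *)
From HB Require Import structures.
Require Import Defs.
From mathcomp Require Import all_boot all_order all_algebra.
From mathcomp Require Import boolp reals exp.
From mathcomp Require Import ring.

Set Implicit Arguments.
Unset Strict Implicit.
Unset Printing Implicit Defensive.

Import Order.TTheory GRing.Theory Num.Theory.
Local Open Scope ring_scope.

(** Put [L = ln a + ln b] and rescale [t] by [1/L]: since
    [a^(-t/L) + b^(t/L) = e^(-t ln a / L) (e^t + 1)], the generating function
    of [E^(-k)_n / L^n] is [2 Li_{-k}(1 - e^-t) e^(X t) / (e^t + 1)].  The
    binomial sum over [k] is the product with [e^(Y u)].  Finally [Li_{-k}] is
    the [k]-th iterate of [z d/dz] on [z / (1 - z)], and [e^(u z d/dz)] maps
    [f(z)] to [f(z e^u)], so the remaining sum over [k] is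
    [z e^u / (1 - z e^u)] at [z = 1 - e^-t]. *)

Lemma fpsC_is_zmod_morphism (R : zmodType) : zmod_morphism (@fpsC R).
Proof.
move=> r s; apply/fpsP => n; rewrite coefsD coefsN /=.
by case: eqP => // _; rewrite subr0.
Qed.

HB.instance Definition _ (R : zmodType) :=
  GRing.isZmodMorphism.Build R {fps R} (@fpsC R) (@fpsC_is_zmod_morphism R).

Lemma fpsC_is_monoid_morphism (R : comNzRingType) : monoid_morphism (@fpsC R).
Proof.
split=> // r s; apply/fpsP => n; rewrite coefsCM /=.
by case: eqP => // _; rewrite mulr0.
Qed.

HB.instance Definition _ (R : comNzRingType) :=
  GRing.isMonoidMorphism.Build R {fps R} (@fpsC R)
    (@fpsC_is_monoid_morphism R).

Definition fps_map {R S : comNzRingType} (phi : {rmorphism R -> S})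
  (f : {fps R}) : {fps S} := Fps (fun n => phi (coefs f n)).

Lemma fps_map_is_zmod_morphism (R S : comNzRingType)
  (phi : {rmorphism R -> S}) : zmod_morphism (fps_map phi).
Proof. by move=> f g; apply/fpsP => n; rewrite /= rmorphB. Qed.

HB.instance Definition _ (R S : comNzRingType) (phi : {rmorphism R -> S}) :=
  GRing.isZmodMorphism.Build {fps R} {fps S} (fps_map phi)
    (fps_map_is_zmod_morphism phi).

Lemma fps_map_is_monoid_morphism (R S : comNzRingType)
  (phi : {rmorphism R -> S}) : monoid_morphism (fps_map phi).
Proof.
split=> [|f g]; apply/fpsP => n /=.
  by case: eqP => _; rewrite ?rmorph0 ?rmorph1.
by rewrite rmorph_sum; apply: eq_bigr => i _; rewrite rmorphM.
Qed.

HB.instance Definition _ (R S : comNzRingType) (phi : {rmorphism R -> S}) :=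
  GRing.isMonoidMorphism.Build {fps R} {fps S} (fps_map phi)
    (fps_map_is_monoid_morphism phi).

(* [f(t)] as a series in [t] and [u]; [f(u)] is [fpsC f]. *)
Local Notation in_t := (fps_map (@fpsC _)).

Lemma coefs_in_tM (R : comNzRingType) (f g : {fps R}) n m :
  coefs (coefs (in_t f * fpsC g) n) m = coefs f n * coefs g m.
Proof. by rewrite mulrC coefsCM mulrC coefsCM. Qed.

Definition fps_scale {R : comNzRingType} (s : R) (f : {fps R}) : {fps R} :=
  Fps (fun n => s ^+ n * coefs f n).

Lemma fps_scale_is_zmod_morphism (R : comNzRingType) (s : R) :
  zmod_morphism (fps_scale s).
Proof. by move=> f g; apply/fpsP => n; rewrite /= mulrBr. Qed.

HB.instance Definition _ (R : comNzRingType) (s : R) :=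
  GRing.isZmodMorphism.Build {fps R} {fps R} (fps_scale s)
    (fps_scale_is_zmod_morphism s).

Lemma fps_scale_is_monoid_morphism (R : comNzRingType) (s : R) :
  monoid_morphism (fps_scale s).
Proof.
split=> [|f g]; apply/fpsP => n /=.
  by case: eqP => [->|_]; rewrite ?mulr0 // expr0 mulr1.
rewrite mulr_sumr; apply: eq_bigr => i _.
have /subnKC {1}<- : (i <= n)%N by rewrite -ltnS.
by rewrite exprD mulrACA.
Qed.

HB.instance Definition _ (R : comNzRingType) (s : R) :=
  GRing.isMonoidMorphism.Build {fps R} {fps R} (fps_scale s)
    (fps_scale_is_monoid_morphism s).

Lemma fps_scale_subst (R : comNzRingType) (s : R) (f g : {fps R}) :
  fps_scale s (fps_subst f g) = fps_subst f (fps_scale s g).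
Proof.
apply/fpsP => n /=; rewrite mulr_sumr; apply: eq_bigr => k _.
by rewrite -rmorphXn /= mulrCA.
Qed.

Lemma coefs_fpsXn (R : comNzRingType) k n :
  coefs (fpsX R ^+ k) n = (n == k)%:R.
Proof.
elim: k n => [|k IH] n; first by rewrite expr0 coefs1; case: eqP.
rewrite exprS coefsM; case: n => [|n]; first by rewrite big_ord1 /= mul0r.
rewrite 2!big_ord_recl /= mul0r add0r mul1r subSS subn0 IH big1 ?addr0 //.
by move=> i _; rewrite mul0r.
Qed.

Lemma coefs_scaled_fpsXn (R : comNzRingType) (r : R) k n :
  coefs ((fpsC r * fpsX R) ^+ k) n = r ^+ k *+ (n == k).
Proof. by rewrite exprMn -rmorphXn coefsCM coefs_fpsXn mulr_natr. Qed.

Lemma fps_subst_scaled_fpsX (R : comNzRingType) (f : {fps R}) (r : R) :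
  fps_subst f (fpsC r * fpsX R) = fps_scale r f.
Proof.
apply/fpsP => n; rewrite [RHS]/= [RHS]mulrC [LHS]/=.
under eq_bigr => k _ do rewrite coefs_scaled_fpsXn mulrnAr mulrb eq_sym.
by rewrite -big_mkcond (big_ord1_eq _ (fun k => coefs f k * r ^+ k)) ltnSn.
Qed.

Lemma coefsMn (R : zmodType) (f : {fps R}) k n :
  coefs (f *+ k) n = coefs f n *+ k.
Proof. by elim: k => [|k IH]; rewrite ?mulr0n // !mulrS coefsD IH. Qed.

Lemma coefs_linear_exp (R : comNzRingType) (p q : R) k n :
  coefs ((fpsC p * fpsX R + fpsC q) ^+ k) n =
  p ^+ n * q ^+ (k - n) *+ 'C(k, n).
Proof.
rewrite addrC exprDn coefs_sum.
under eq_bigr => i _.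
  rewrite coefsMn -(rmorphXn (@fpsC R)) coefsCM coefs_scaled_fpsXn.
  rewrite mulrnAr mulrnAC mulrb eq_sym; over.
rewrite -big_mkcond.
rewrite (big_ord1_eq _ (fun i => q ^+ (k - i) * p ^+ i *+ 'C(k, i))).
by rewrite ltnS mulrC; case: leqP => [_|/bin_small ->].
Qed.

Lemma coefs_fps2_subst_linear (R : comNzRingType) (f : {fps R}) (r s : R) n m :
  coefs (coefs (fps2_subst f (fps2C r * fps2_t R + fps2C s * fps2_u R)) n) m =
  coefs f (n + m)%N * (r ^+ n * s ^+ m *+ 'C(n + m, n)).
Proof.
have coefs_pow k :
    coefs (coefs ((fps2C r * fps2_t R + fps2C s * fps2_u R) ^+ k) n) m =
    r ^+ n * s ^+ m *+ 'C(k, n) *+ (k == n + m)%N.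
  rewrite /fps2_u /fps2C /fps2_t -(rmorphM (@fpsC _)) coefs_linear_exp coefsMn.
  rewrite -(rmorphXn (@fpsC _)) coefsCM coefs_scaled_fpsXn.
  have [nk|/bin_small -> //] := leqP n k; last by rewrite mul0rn.
  have -> : (k == n + m)%N = (m == k - n)%N.
    by rewrite -{1}(subnKC nk) eqn_add2l eq_sym.
  by rewrite mulrnAr mulrnAC; case: eqP => [->|].
rewrite [LHS]/=.
under eq_bigr => k _ do rewrite coefs_pow mulrnAr mulrb.
rewrite -big_mkcond.
rewrite (big_ord1_eq _ (fun k => coefs f k * (r ^+ n * s ^+ m *+ 'C(k, n)))).
by rewrite ltnSn.
Qed.

Lemma binr_div_fact (R : numFieldType) n k : (k <= n)%N ->
  'C(n, k)%:R / n`!%:R = (k`!%:R)^-1 * ((n - k)`!%:R)^-1 :> R.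
Proof.
move=> kn; rewrite -(bin_fact kn) !natrM [in LHS]invfM mulVKf ?invfM //.
by rewrite pnatr_eq0 -lt0n bin_gt0.
Qed.

Definition fps_egf {R : unitRingType} (p : nat -> R) : {fps R} :=
  Fps (fun n => p n / n`!%:R).

Lemma fps_egfM (R : numFieldType) (p q : nat -> R) :
  fps_egf p * fps_egf q =
  fps_egf (fun n => \sum_(k < n.+1) p k * q (n - k)%N *+ 'C(n, k)).
Proof.
apply/fpsP => n; rewrite coefsM [RHS]/= mulr_suml; apply: eq_bigr => k _ /=.
by rewrite mulrACA -binr_div_fact -1?ltnS // mulrA mulr_natr.
Qed.

Lemma fps_scale_egf (R : comUnitRingType) (s : R) (p : nat -> R) :
  fps_scale s (fps_egf p) = fps_egf (fun n => s ^+ n * p n).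
Proof. by apply/fpsP => n /=; rewrite mulrA. Qed.

Definition fps_expX {R : unitRingType} (r : R) : {fps R} :=
  fps_egf (fun n => r ^+ n).

Lemma coefs_fps_expX0 (R : unitRingType) (r : R) : coefs (fps_expX r) 0%N = 1.
Proof. by rewrite /= expr0 divr1. Qed.

Lemma fps_expX_unit (R : comUnitRingType) (r : R) :
  fps_expX r \is a GRing.unit.
Proof. by rewrite fps_unitE coefs_fps_expX0 unitr1. Qed.

Lemma fps_expXD1_unit (R : numFieldType) (r : R) :
  fps_expX r + 1 \is a GRing.unit.
Proof. by rewrite fps_unitE coefsD coefs_fps_expX0 unitfE (pnatr_eq0 R 2). Qed.

Lemma fps_expX0 (R : comUnitRingType) : fps_expX 0 = 1 :> {fps R}.
Proof.
by apply/fpsP => -[|n]; rewrite ?coefs_fps_expX0 //= expr0n mul0r.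
Qed.

Lemma fps_expXD (R : numFieldType) (r s : R) :
  fps_expX (r + s) = fps_expX r * fps_expX s.
Proof.
rewrite fps_egfM; apply/fpsP => n /=; rewrite addrC exprDn.
by under eq_bigr do rewrite mulrC.
Qed.

Lemma fps_expXN (R : numFieldType) (r : R) :
  fps_expX (- r) = (fps_expX r)^-1.
Proof.
apply: (mulrI (fps_expX_unit r)).
by rewrite -fps_expXD subrr fps_expX0 divrr // fps_expX_unit.
Qed.

Lemma fps_expX_nat (R : numFieldType) n :
  fps_expX n%:R = fps_expX 1 ^+ n :> {fps R}.
Proof.
by elim: n => [|n IH]; rewrite ?fps_expX0 // -natr1 fps_expXD IH exprSr.
Qed.

Lemma fps_scale_expX (R : comUnitRingType) (s r : R) :
  fps_scale s (fps_expX r) = fps_expX (s * r).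
Proof. by rewrite fps_scale_egf; apply/fpsP => n; rewrite /= exprMn. Qed.

Lemma fps_powE (R : realType) (a r : R) : fps_pow a r = fps_expX (r * ln a).
Proof. exact: fps_subst_scaled_fpsX. Qed.

Lemma fps2_exp_linear (R : numFieldType) (r s : R) :
  fps2_exp (fps2C r * fps2_t R + fps2C s * fps2_u R) =
  in_t (fps_expX r) * fpsC (fps_expX s).
Proof.
apply/fpsP => n; apply/fpsP => m; rewrite coefs_in_tM coefs_fps2_subst_linear.
have := @binr_div_fact R _ _ (leq_addr m n); rewrite addKn => binr_nm.
by rewrite /= [RHS]mulrACA -binr_nm [RHS]mulrA mulr_natr mulrC.
Qed.

Lemma fps2_exp_scaled_t (R : numFieldType) (r : R) :
  fps2_exp (fps2C r * fps2_t R) = in_t (fps_expX r).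
Proof.
have := fps2_exp_linear r 0.
by rewrite fps_expX0 /fps2C !rmorph0 !rmorph1 mul0r addr0 mulr1.
Qed.

Lemma fps2_exp_scaled_u (R : numFieldType) (s : R) :
  fps2_exp (fps2C s * fps2_u R) = fpsC (fps_expX s).
Proof.
have := fps2_exp_linear 0 s.
by rewrite fps_expX0 /fps2C !rmorph0 !rmorph1 mul0r add0r mul1r.
Qed.

Lemma fps2_exp_t (R : numFieldType) :
  fps2_exp (fps2_t R) = in_t (fps_expX 1).
Proof. by rewrite -fps2_exp_scaled_t /fps2C !rmorph1 mul1r. Qed.

Lemma fps2_exp_u (R : numFieldType) :
  fps2_exp (fps2_u R) = fpsC (fps_expX 1).
Proof. by rewrite -fps2_exp_scaled_u /fps2C !rmorph1 mul1r. Qed.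

Lemma fps2_exp_tDu (R : numFieldType) :
  fps2_exp (fps2_t R + fps2_u R) = fps2_exp (fps2_t R) * fps2_exp (fps2_u R).
Proof.
have := fps2_exp_linear (1 : R) 1.
by rewrite /fps2C !rmorph1 !mul1r fps2_exp_t fps2_exp_u.
Qed.

Lemma fps2_exp_tN (R : numFieldType) :
  fps2_exp (- fps2_t R) = (fps2_exp (fps2_t R))^-1.
Proof.
rewrite fps2_exp_t -rmorphV ?fps_expX_unit // -fps_expXN.
by rewrite -[RHS]fps2_exp_scaled_t /fps2C !rmorphN !rmorph1 mulN1r.
Qed.

Lemma fps2_exp_t_unit (R : numFieldType) :
  fps2_exp (fps2_t R) \is a GRing.unit.
Proof. by rewrite fps2_exp_t rmorph_unit ?fps_expX_unit. Qed.

Lemma fps2_exp_tD1_unit (R : numFieldType) :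
  fps2_exp (fps2_t R) + 1 \is a GRing.unit.
Proof.
by rewrite fps2_exp_t -(rmorph1 in_t) -rmorphD rmorph_unit ?fps_expXD1_unit.
Qed.

Lemma invr1B_fps (R : comUnitRingType) (w : {fps R}) :
  coefs w 0%N = 0 -> (1 - w)^-1 = fps_subst (Fps (fun=> 1)) w.
Proof.
move=> w0; have w1 : coefs (1 - w) 0%N = 1 by rewrite coefsD coefsN w0 subr0.
rewrite [LHS]/GRing.inv /= /fps_inv unfold_in w1 unitr1 invr1.
by rewrite (rmorph1 (@fpsC R)) !mul1r opprB addrC subrK.
Qed.

(* [X / (1 - X)] *)
Definition fps_geom (R : comNzRingType) : {fps R} :=
  Fps (fun n => (n != 0%N)%:R).

Lemma fps_subst_geom (R : comUnitRingType) (w : {fps R}) :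
  coefs w 0%N = 0 -> fps_subst (fps_geom R) w = w / (1 - w).
Proof.
move=> w0; have uw : 1 - w \is a GRing.unit.
  by rewrite fps_unitE coefsD coefsN w0 subr0 unitr1.
rewrite -[X in X / _](subKr 1 w) mulrBl divrr // mul1r invr1B_fps //.
apply/fpsP => n; rewrite coefsD coefsN /= !big_ord_recl /=.
by rewrite mul0r add0r mul1r addrAC subrr add0r.
Qed.

Lemma fps_map_geom (R S : comNzRingType) (phi : {rmorphism R -> S}) :
  fps_map phi (fps_geom R) = fps_geom S.
Proof. by apply/fpsP => n; rewrite /= rmorph_nat. Qed.

(* The [k]-th iterate of [X d/dX] *)
Definition fps_theta {R : comNzRingType} (k : nat) (f : {fps R}) : {fps R} :=
  Fps (fun n => n%:R ^+ k * coefs f n).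

Lemma Li_negE (R : realType) (k : nat) :
  Li R (- k%:Z) = fps_theta k (fps_geom R).
Proof.
apply/fpsP => -[|n] /=; first by rewrite mulr0.
by rewrite -exprnN invrK mulr1.
Qed.

(* [\sum_k P_k u^k / k!] *)
Definition fps2_egf {R : unitRingType} (P : nat -> {fps R}) : {fps {fps R}} :=
  Fps (fun n => fps_egf (fun k => coefs (P k) n)).

Lemma fps2_egf_in_tM (R : numFieldType) (P : nat -> {fps R}) (f : {fps R}) :
  fps2_egf P * in_t f = fps2_egf (fun k => P k * f).
Proof.
apply/fpsP => n; apply/fpsP => k; rewrite coefsM coefs_sum [RHS]/= mulr_suml.
by apply: eq_bigr => i _; rewrite [X in coefs X k]mulrC coefsCM /= mulrCA mulrA.
Qed.

Lemma fps2_egf_theta (R : numFieldType) (f z : {fps R}) :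
  fps2_egf (fun k => fps_subst (fps_theta k f) z) =
  fps_subst (in_t f) (in_t z * fpsC (fps_expX 1)).
Proof.
apply/fpsP => n; apply/fpsP => k; rewrite [LHS]/= [RHS]/= coefs_sum mulr_suml.
apply: eq_bigr => j _; rewrite exprMn -(rmorphXn in_t) -(rmorphXn (@fpsC _)).
by rewrite -fps_expX_nat coefsCM coefs_in_tM /=; ring.
Qed.

Lemma fps2_egf_Li (R : realType) (z : {fps R})
    (w := in_t z * fpsC (fps_expX 1)) :
  coefs z 0%N = 0 ->
  fps2_egf (fun k => fps_subst (Li R (- k%:Z)) z) = w / (1 - w).
Proof.
move=> z0; have w0 : coefs w 0%N = 0.
  by rewrite coefsM big_ord1 /= z0 (rmorph0 (@fpsC R)) mul0r.
rewrite -fps_subst_geom // -(fps_map_geom (@fpsC R)) -fps2_egf_theta.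
by congr fps2_egf; apply/funext => k; rewrite Li_negE.
Qed.

Lemma geom_quotient_1BVM (A : comUnitRingType) (p q : A) :
    p \is a GRing.unit -> p + q - p * q \is a GRing.unit ->
  let w := (1 - p^-1) * q in
  w / (1 - w) = (1 - p^-1) * (p * q) / (p + q - p * q).
Proof.
move=> p_unit den_unit w.
have -> : 1 - w = p^-1 * (p + q - p * q).
  by rewrite mulrBr mulrDr mulVr // mulKr // /w; ring.
by rewrite invrM ?unitrV // invrK /w; ring.
Qed.

Lemma fps2_egf_Li_den_unit (R : realType) :
  fps2_exp (fps2_t R) + fps2_exp (fps2_u R) - fps2_exp (fps2_t R + fps2_u R)
    \is a GRing.unit.
Proof. by have := Dmn_gf_den_unit R; rewrite /= unitrM => /andP[]. Qed.

Lemma fps2_egf_Li_1BexpN (R : realType) (t := fps2_t R) (u := fps2_u R)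
    (e := @fps2_exp R) :
  fps2_egf (fun k => fps_subst (Li R (- k%:Z)) (1 - fps_expX (-1))) =
  (1 - e (- t)) * e (t + u) / (e t + e u - e (t + u)).
Proof.
have := fps2_egf_Li_den_unit R; rewrite fps2_exp_tDu => den_unit.
rewrite [e (t + u)]fps2_exp_tDu [e (- t)]fps2_exp_tN.
rewrite fps2_egf_Li; last by rewrite coefsD coefsN coefs_fps_expX0 subrr.
have -> : in_t (1 - fps_expX (-1)) = 1 - (e t)^-1.
  rewrite [e t]fps2_exp_t rmorphB rmorph1 fps_expXN.
  by rewrite rmorphV ?fps_expX_unit.
by rewrite -fps2_exp_u geom_quotient_1BVM ?fps2_exp_t_unit.
Qed.

Lemma fps_scale_polyEuler_gf (R : realType) (k : int) (x a b c : R) :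
    0 < a -> 0 < b -> a * b != 1 ->
  fps_scale (ln a + ln b)^-1 (polyEuler_gf k x a b c) =
  fps_subst (Li R k) (1 - fps_expX (-1)) *
    (2 * fps_expX ((x * ln c + ln a) / (ln a + ln b)) / (fps_expX 1 + 1)).
Proof.
move=> a_gt0 b_gt0 ab_neq1; set L := ln a + ln b.
have lnab : ln (a * b) = L by rewrite lnM ?posrE.
have L_neq0 : L != 0 by rewrite -lnab ln_eq0 ?mulr_gt0.
have Li_arg : fps_scale L^-1 (1 - fps_pow (a * b) (-1)) = 1 - fps_expX (-1).
  rewrite rmorphB rmorph1 /= fps_powE fps_scale_expX lnab.
  by rewrite mulrCA mulVf ?mulr1.
have den : fps_scale L^-1 (fps_pow a (-1) + fps_pow b 1) =
    fps_expX (- (ln a / L)) * (fps_expX 1 + 1).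
  rewrite rmorphD /= !fps_powE !fps_scale_expX mulrDr mulr1 -fps_expXD addrC.
  by congr (fps_expX _ + fps_expX _); rewrite /L in L_neq0 *; field.
have num : (x * ln c + ln a) / L = L^-1 * (x * ln c) + ln a / L.
  by rewrite mulrDl [_ / L]mulrC.
rewrite /polyEuler_gf !rmorphM rmorphV ?polyEuler_gf_den_unit //=.
rewrite rmorph_nat fps_scale_subst Li_arg den.
rewrite invrM ?fps_expX_unit ?fps_expXD1_unit //.
by rewrite -fps_expXN opprK fps_powE fps_scale_expX num fps_expXD; ring.
Qed.

Lemma fps2_egf_polyEuler (R : realType) (x a b c : R) (t := fps2_t R)
    (e := @fps2_exp R) (X := fps2C ((x * ln c + ln a) / (ln a + ln b))) :
    0 < a -> 0 < b -> a * b != 1 ->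
  fps2_egf (fun k =>
    fps_scale (ln a + ln b)^-1 (polyEuler_gf (- k%:Z) x a b c)) =
  fps2_egf (fun k => fps_subst (Li R (- k%:Z)) (1 - fps_expX (-1))) *
    (2 * e (X * t) / (e t + 1)).
Proof.
move=> a_gt0 b_gt0 ab_neq1.
rewrite [e t]fps2_exp_t [e (X * t)]fps2_exp_scaled_t.
rewrite -(rmorph_nat in_t 2) -(rmorph1 in_t) -!(rmorphM in_t) -(rmorphD in_t).
rewrite -(rmorphV in_t) ?fps_expXD1_unit // -(rmorphM in_t) fps2_egf_in_tM.
by congr fps2_egf; apply/funext => k; exact: fps_scale_polyEuler_gf.
Qed.

Lemma Dmn_egf (R : realType) (x y a b c : R) :
  Fps (fun n => Fps (fun m => Dmn m n x y a b c / n`!%:R / m`!%:R)) =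
  fps2_egf (fun k =>
    fps_scale (ln a + ln b)^-1 (polyEuler_gf (- k%:Z) x a b c)) *
  fps2_exp (fps2C ((y * ln c + ln a) / (ln a + ln b)) * fps2_u R).
Proof.
rewrite fps2_exp_scaled_u; apply/fpsP => n.
rewrite mulrC coefsCM mulrC fps_egfM.
apply: (congr1 fps_egf); apply/funext => m.
rewrite /Dmn big_mkord mulr_sumr mulr_suml; apply: eq_bigr => k _.
by rewrite polyEuler_gfE /= exprVn; ring.
Qed.

Theorem theorem2p4 (R : realType) (a b c x y : R)
    (a_gt0 : 0 < a) (b_gt0 : 0 < b) (c_gt0 : 0 < c) (ab_neq1 : a * b != 1) :
  let t := fps2_t R in
  let u := fps2_u R in
  let e := @fps2_exp R in
  let X := fps2C ((x * ln c + ln a) / (ln a + ln b)) in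
  let Y := fps2C ((y * ln c + ln a) / (ln a + ln b)) in
  Fps (fun n => Fps (fun m => Dmn m n x y a b c / n`!%:R / m`!%:R)) =
  2 * e (Y * u) * e (X * t) * e (t + u) * (1 - e (- t))
    / ((e t + 1) * (e t + e u - e (t + u))).
Proof.
move=> t u e X Y.
rewrite Dmn_egf fps2_egf_polyEuler // fps2_egf_Li_1BexpN.
rewrite invrM ?fps2_exp_tD1_unit ?fps2_egf_Li_den_unit //.
rewrite -/t -/u -/e -/X -/Y; clearbody t u e X Y; ring.
Qed.
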